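(* Let $I\subset\mathbf k[\mathbf x]$ be a monomial ideal with cofinite support and $x_j\notin I$ for all $j$. Let $e_i$ be a root and let $e_i=\alpha+\beta$ with $\alpha,\beta\in\mathcal R(I)$. Then, after possibly exchanging the two summands, exactly one of the following holds, with $k,l,i$ pairwise distinct: (A) $\alpha=e_i-e_k$ and $\beta=e_k$; (B) $\alpha=e_k-e_i$ and $\beta=2e_i-e_k$; (C) $\alpha=e_k-e_l$ and $\beta=e_i-e_k+e_l$.
   Context: $\mathbf k$ is an algebraically closed field of characteristic zero, $\mathbf k[\mathbf x]=\mathbf k[x_1,\dots,x_n]$, $\mathbf x^m=x_1^{m_1}\cdots x_n^{m_n}$, and $e_1,\dots,e_n$ is the canonical basis of $\mathbb Z^n$. A monomial ideal $I$ has cofinite support if only finitely many monomials lie outside $I$; $\operatorname{supp}(I)=\{m\in\mathbb Z^n_{\ge0}:\mathbf x^m\in I\}$. The algebra $A=\mathbf k[\mathbf x]/I$ is $\mathbb Z^n_{\ge0}$-graded, and a derivation of $A$ is homogeneous of degree $\alpha\in\mathbb Z^n$ if it sends $\overline{\mathbf x}^m$ to a scalar multiple of $\overline{\mathbf x}^{m+\alpha}$. A root is a degree $\alpha\neq0$ for which there is a nonzero homogeneous derivation of $A$ of degree $\alpha$; $\mathcal R(I)$ is the set of roots. Explicitly, with $E_\alpha=\{e_j : \alpha+e_j\in\mathbb Z^n_{\ge0}\setminus\operatorname{supp}(I)\}$: an $\alpha\in\mathbb Z^n_{\ge0}\setminus\{0\}$ is a root (called inner) iff $E_\alpha\ne\varnothing$;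 an $\alpha\notin\mathbb Z^n_{\ge0}$ is a root (called outer) iff it has exactly one negative coordinate, equal to $-1$, for every $\beta\in\operatorname{supp}(I)$ either $\alpha+\beta\in\operatorname{supp}(I)$ or $\alpha+\beta\notin\mathbb Z^n_{\ge0}$, and $E_\alpha\neq\varnothing$. *)

(* Defs.v *)
From HB Require Import structures.
From mathcomp Require Import all_boot all_order all_algebra.
From mathcomp Require Export ring_quotient mpoly.

Set Implicit Arguments.
Unset Strict Implicit.
Unset Printing Implicit Defensive.

Import GRing.Theory.
Local Open Scope ring_scope.
Local Open Scope quotient_scope.

Section MonomialIdeals.

Variables (k : fieldType) (n : nat).

(* The generating set S of monomials may be infinite; members of the ideal are
   the finite combinations of elements of S with polynomial coefficients. *)
Definition generated_by (I : {pred {mpoly k[n]}}) (S : 'X_{1..n} -> Prop) :=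
  forall p : {mpoly k[n]}, p \in I <->
    exists s : seq ({mpoly k[n]} * 'X_{1..n}),
      (forall u, u \in s -> S u.2) /\ p = \sum_(u <- s) u.1 * 'X_[u.2].

Definition monomial_ideal (I : {pred {mpoly k[n]}}) :=
  exists S : 'X_{1..n} -> Prop, generated_by I S.

Definition cofinite_support (I : {pred {mpoly k[n]}}) :=
  exists s : seq 'X_{1..n}, forall m, 'X_[m] \notin I -> m \in s.

End MonomialIdeals.

(* The library only makes {ideal_quot I} a ring; this copy also carries the
   k-module structure of k[x]/I. *)
Definition qalg (k : fieldType) (n : nat) (I : idealr {mpoly k[n]}) : Type :=
  {ideal_quot I}.

Section QuotientAlgebra.

Variables (k : fieldType) (n : nat) (I : idealr {mpoly k[n]}).
Local Notation A := (qalg I).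

HB.instance Definition _ := GRing.ComNzRing.on A.

Definition qclass (p : {mpoly k[n]}) : A := \pi_{ideal_quot I} p.

Definition qscale (c : k) (a : A) : A := qclass c%:MP * a.

Fact qclassM : {morph qclass : p q / p * q}.
Proof. exact: (rmorphM \pi_{ideal_quot I}). Qed.

Fact qclassD : {morph qclass : p q / p + q}.
Proof. exact: (rmorphD \pi_{ideal_quot I}). Qed.

Fact qclass1 : qclass 1 = 1.
Proof. exact: (rmorph1 \pi_{ideal_quot I}). Qed.

Fact qscaleA c d a : qscale c (qscale d a) = qscale (c * d) a.
Proof. by rewrite /qscale mulrA -qclassM mpolyCM. Qed.

Fact qscale1 : left_id 1 qscale.
Proof. by move=> a; rewrite /qscale mpolyC1 qclass1 mul1r. Qed.

Fact qscaleDr : right_distributive qscale +%R.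
Proof. by move=> c a b; rewrite /qscale mulrDr. Qed.

Fact qscaleDl a : {morph qscale^~ a : c d / c + d}.
Proof. by move=> c d; rewrite /qscale mpolyCD qclassD mulrDl. Qed.

HB.instance Definition _ :=
  GRing.Zmodule_isLmodule.Build k A qscaleA qscale1 qscaleDr qscaleDl.

Definition expo (m : 'X_{1..n}) : 'rV[int]_n := \row_j (m j)%:Z.

(* The class of x^g, read as 0 when g has a negative coordinate: the
   corresponding graded piece of A is zero. *)
Definition qmonomial (g : 'rV[int]_n) : A :=
  if [forall j, 0 <= g 0 j]
  then qclass 'X_[[multinom absz (g 0%R j) | j < n]] else 0.

Definition derivation (D : {linear A -> A}) :=
  forall a b : A, D (a * b) = D a * b + a * D b.

Definition homogeneous (D : {linear A -> A}) (alpha : 'rV[int]_n) :=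
  forall m : 'X_{1..n}, exists c : k,
    D (qmonomial (expo m)) = c *: qmonomial (expo m + alpha).

Definition is_root (alpha : 'rV[int]_n) :=
  alpha != 0 /\
  exists D : {linear A -> A},
    [/\ derivation D, homogeneous D alpha & exists a, D a != 0].

End QuotientAlgebra.

Definition evec (n : nat) (i : 'I_n) : 'rV[int]_n := delta_mx 0 i.

Section Decompositions.

Variables (n : nat) (i : 'I_n) (alpha beta : 'rV[int]_n).

Definition typeA := exists k : 'I_n,
  [/\ k != i, alpha = evec i - evec k & beta = evec k].

Definition typeB := exists k : 'I_n,
  [/\ k != i, alpha = evec k - evec i & beta = evec i *+ 2 - evec k].

Definition typeC := exists k l : 'I_n,
  [/\ uniq [:: k; l; i], alpha = evec k - evec l
    & beta = evec i - evec k + evec l].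

End Decompositions.

Definition exactly_one (P Q R : Prop) :=
  [\/ [/\ P, ~ Q & ~ R], [/\ ~ P, Q & ~ R] | [/\ ~ P, ~ Q & R]].

(* Main.v *)
Require Import Defs.
From HB Require Import structures.
From mathcomp Require Import all_boot all_order all_algebra.
From mathcomp Require Import zify.
Import Order.TTheory GRing.Theory Num.Theory.
Local Open Scope ring_scope.
Local Open Scope quotient_scope.

Set Implicit Arguments.
Unset Strict Implicit.
Unset Printing Implicit Defensive.

(** Only two facts about roots matter. First, a derivation of k[x]/I is
    determined by its values on the variables, so a nonzero homogeneous one of
    degree alpha has D x_p != 0 for some p. That value is a multiple of
    x^(alpha + e_p), hence alpha + e_p >= 0 coordinatewise (root_nonneg).
    Second, alpha is never - e_l (root_neq_oppevec): such a D would send x_l to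
    a nonzero constant c, and then D (x_l^(d+1)) = (d+1) c x_l^d shows in
    characteristic zero that no power of x_l vanishes in the quotient, whereas
    cofinite support makes x_l nilpotent.

    The rest is arithmetic in Z^n. Let e_i = alpha + beta with alpha + e_p >= 0
    and beta + e_q >= 0. The summands cannot both be nonnegative, for one of
    them would be 0. Say alpha has a negative coordinate; it is the p-th one
    and equals -1. Put g = alpha + e_p. Then g_p = 0 and 0 <= g <= e_i + e_q,
    so g is 0, e_i, e_q or e_i + e_q. The value 0 is the excluded root - e_p,
    and each of the others gives one of the three types according to which of
    i, p, q coincide (outer_decomposition).

    The types exclude one another: in (A) one summand is nonnegative, while in
    (B) and (C) neither is; the i-th coordinates of the summands are -1 and 2
    in (B) but 0 and 1 in (C). *)

(** * Derivations of the quotient algebra *)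

Section QuotientDerivations.

Variables (k : fieldType) (n : nat) (I : idealr {mpoly k[n]}).
Local Notation A := (qalg I).

Lemma qclass_surj (a : A) : exists p, a = qclass I p.
Proof. by exists (repr a); rewrite /qclass reprK. Qed.

Lemma qclass_eq0 p : (qclass I p == 0) = (p \in I).
Proof.
have <- : qclass I 0 = 0 by exact: (rmorph0 \pi_{ideal_quot I}).
by rewrite -[p in RHS]subr0 Quotient.idealrBE.
Qed.

Lemma qclassX p d : qclass I (p ^+ d) = qclass I p ^+ d.
Proof. exact: (rmorphXn \pi_{ideal_quot I}). Qed.

Lemma qclassZ c p : qclass I (c *: p) = c *: qclass I p.
Proof. by rewrite -mul_mpolyC qclassM. Qed.

Lemma qscaler_eq0 (c : k) (a : A) : c != 0 -> c *: a = 0 -> a = 0.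
Proof. by move=> c0 /eqP; rewrite scaler_eq0 (negPf c0) => /eqP. Qed.

Lemma qmonomial_expo m : qmonomial I (expo m) = qclass I 'X_[m].
Proof.
rewrite /qmonomial ifT; last by apply/forallP=> j; rewrite mxE.
by congr (qclass I 'X_[_]); apply/mnmP=> j; rewrite mnmE mxE.
Qed.

Lemma expo_mnm1 (j : 'I_n) : expo U_(j)%MM = evec j.
Proof.
by apply/rowP=> h; rewrite !mxE mnm1E eqxx /= eq_sym; case: eqP.
Qed.

Section OneDerivation.

Variables (D : {linear A -> A}) (derD : derivation D).

Lemma derivation1 : D 1 = 0.
Proof.
have := derD 1 1; rewrite !mul1r mulr1 => e.
by apply: (addrI (D 1)); rewrite addr0 -e.
Qed.

Lemma derivationX (t : A) d : D (t ^+ d.+1) = (t ^+ d * D t) *+ d.+1.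
Proof.
elim: d => [|d IHd]; first by rewrite expr1 expr0 mul1r.
by rewrite exprS derD IHd mulrnAr mulrA -exprS [D t * _]mulrC -mulrS.
Qed.

(** The kernel of a derivation is a subalgebra, and the classes of the
    variables generate the quotient. *)
Lemma derivation_eq0 :
  (forall j : 'I_n, D (qclass I 'X_j) = 0) -> forall a, D a = 0.
Proof.
move=> DX a; have [p ->] := qclass_surj a.
have DXm m : D (qclass I 'X_[m]) = 0.
  rewrite mpolyXE_id.
  elim/big_ind: _ => [|p1 p2 e1 e2|j _]; first by rewrite qclass1 derivation1.
    by rewrite qclassM derD e1 e2 mul0r mulr0 addr0.
  case: (m j) => [|d]; first by rewrite expr0 qclass1 derivation1.
  by rewrite qclassX derivationX DX mulr0 mul0rn.
elim/mpolyind: p => [|c m p _ _ IHp].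
  have -> : qclass I 0 = 0 by apply/eqP; rewrite qclass_eq0 rpred0.
  by rewrite linear0.
by rewrite qclassD qclassZ linearD linearZ /= DXm IHp scaler0 addr0.
Qed.

(** If t^(d+1) = 0, applying D gives (d+1) c t^d = 0, so t^d = 0 already; a
    descent on d ends at 1 = 0. *)
Lemma derivation_unit_not_nilpotent (t : A) (c : k) :
  [pchar k] =i pred0 -> D t = c *: (1 : A) -> c != 0 -> forall d, t ^+ d != 0.
Proof.
move=> char0 Dt c0; elim=> [|d IHd]; first by rewrite expr0 oner_neq0.
apply: contra_neq IHd => td0.
have := derivationX t d.
have -> : (t ^+ d * D t) *+ d.+1 = (c * d.+1%:R) *: t ^+ d.
  rewrite Dt mulr_natr -scalerMnl; congr (_ *+ _).
  by rewrite /GRing.scale /= /qscale mulr1 mulrC.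
rewrite td0 linear0 => /esym; apply: qscaler_eq0.
by rewrite mulf_neq0 // ((pcharf0P k).1 char0).
Qed.

End OneDerivation.

(** * Degrees of homogeneous derivations *)

Definition nonneg (g : 'rV[int]_n) := forall h, 0 <= g 0 h.

Lemma qmonomial_neq0 g : qmonomial I g != 0 -> nonneg g.
Proof. by rewrite /qmonomial; case: forallP => //; rewrite eqxx. Qed.

Lemma homogeneous_var (D : {linear A -> A}) alpha (j : 'I_n) :
    homogeneous D alpha ->
  exists c : k, D (qclass I 'X_j) = c *: qmonomial I (evec j + alpha).
Proof. by move=> /(_ U_(j)%MM); rewrite qmonomial_expo expo_mnm1. Qed.

Lemma root_var alpha : is_root I alpha ->
  exists D : {linear A -> A}, [/\ derivation D, homogeneous D alpha
    & exists j : 'I_n, D (qclass I 'X_j) != 0].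
Proof.
case=> _ [D [derD homD [a Da]]]; exists D; split=> //.
apply/existsP; apply: contra_neqT Da; rewrite negb_exists => /forallP D0.
by apply: derivation_eq0 => // j; apply/eqP; rewrite -[_ == _]negbK D0.
Qed.

(** The p-th variable is one on which the derivation does not vanish: its image
    lies in degree alpha + e_p, and that graded piece must be nonzero. *)
Lemma root_nonneg alpha : is_root I alpha ->
  exists p : 'I_n, nonneg (alpha + evec p).
Proof.
case/root_var=> D [derD homD [p Dp]]; exists p.
have [c Dpc] := homogeneous_var p homD.
apply: qmonomial_neq0; apply: contra_neq Dp; rewrite Dpc addrC => ->.
by rewrite scaler0.
Qed.

Lemma cofinite_nilpotent (j : 'I_n) :
  cofinite_support I -> exists d, qclass I 'X_j ^+ d = 0.
Proof.
case=> s sP.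
(* B bounds the j-th exponent of every monomial outside I. *)
pose B := \sum_(m <- s) m j.
have leB m : m \in s -> (m j <= B)%N.
  by move=> ms; rewrite /B (big_rem m ms) leq_addr.
exists B.+1; apply/eqP; rewrite -qclassX qclass_eq0 mpolyXn.
apply/negPn/negP=> /sP/leB.
by rewrite mulmnE mnm1E eqxx mul1n ltnn.
Qed.

(** A derivation of degree - e_l kills the other variables and maps x_l to a
    constant, which is nonzero; but x_l is nilpotent. *)
Lemma root_neq_oppevec alpha (l : 'I_n) : [pchar k] =i pred0 ->
  cofinite_support I -> is_root I alpha -> alpha <> - evec l.
Proof.
move=> char0 cof + eal; rewrite {}eal.
case/root_var=> D [derD homD [p Dp]].
have [c Dpc] := homogeneous_var p homD.
have [epl|npl] := eqVneq p l; last first.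
  have /(_ l) : nonneg (evec p - evec l).
    apply: qmonomial_neq0; apply: contra_neq Dp; rewrite Dpc => ->.
    exact: scaler0.
  by rewrite !mxE eqxx /= eqxx (eq_sym l) (negPf npl).
have qm1 : qmonomial I (evec p - evec l) = 1.
  have -> : evec p - evec l = expo 0%MM.
    by rewrite epl subrr; apply/rowP=> h; rewrite !mxE mnm0E.
  by rewrite qmonomial_expo mpolyX0 qclass1.
rewrite qm1 in Dpc.
have c0 : c != 0 by apply: contra_neq Dp => c0; rewrite Dpc c0 scale0r.
have [d td0] := cofinite_nilpotent p cof.
by have := derivation_unit_not_nilpotent derD char0 Dpc c0 d; rewrite td0 eqxx.
Qed.

End QuotientDerivations.

(** * Decompositions of a unit vector *)

Section UnitVectors.

Variable n : nat.
Implicit Types (i k l p q : 'I_n) (alpha beta g d : 'rV[int]_n).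

Lemma evecE i h : evec i 0 h = (h == i)%:R.
Proof. by rewrite mxE eqxx. Qed.

Lemma nonneg_evec i : nonneg (evec i).
Proof. by move=> h; rewrite evecE; case: eqP. Qed.

(** A vector between 0 and d + e_q either has q-th coordinate 0 and then lies
    below d, or e_q can be subtracted from it. Peeling off unit vectors this way
    lists the vectors below a sum of unit vectors, whether or not these
    coincide. *)
Lemma nonneg_sub_evec g d q :
    nonneg d -> nonneg g -> nonneg (d + evec q - g) ->
  nonneg (d - g) \/ nonneg (g - evec q).
Proof.
move=> d0 g0 dg; have [gq|gq] := eqVneq (g 0 q) 0; [left|right] => h.
  have := dg h; have := d0 h; rewrite !mxE eqxx /=.
  by case: (h =P q) => [->|_] /=; lia.
have := g0 h; rewrite !mxE eqxx /=.
by case: (h =P q) => [->|_] /=; lia.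
Qed.

Lemma nonneg_anti g : nonneg g -> nonneg (- g) -> g = 0.
Proof.
move=> g0 g1; apply/rowP=> h; rewrite [RHS]mxE.
by apply/le_anti; rewrite g0 andbT -oppr_ge0; have := g1 h; rewrite mxE.
Qed.

Lemma nonneg_sub_evec1 g i : nonneg g -> nonneg (evec i - g) ->
  g = 0 \/ g = evec i.
Proof.
rewrite -[evec i]add0r => g0 gi.
have d0 : nonneg (0 : 'rV[int]_n) by move=> h; rewrite mxE.
case: (nonneg_sub_evec d0 g0 gi) => [|gi']; rewrite ?sub0r ?add0r.
  by left; apply: nonneg_anti.
right; apply: subr0_eq; apply: nonneg_anti => //.
by rewrite opprB -[evec i]add0r.
Qed.

Lemma nonneg_sub_evec2 g i q : nonneg g -> nonneg (evec i + evec q - g) ->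
  [\/ g = 0, g = evec i, g = evec q | g = evec i + evec q].
Proof.
move=> g0 giq; case: (nonneg_sub_evec (nonneg_evec i) g0 giq) => [gi|gq].
  by case: (nonneg_sub_evec1 g0 gi) => ->; [constructor 1|constructor 2].
have := @nonneg_sub_evec1 (g - evec q) i gq; rewrite opprB addrA.
case=> // [/subr0_eq ->|e]; first by constructor 3.
by constructor 4; rewrite -e subrK.
Qed.

Lemma nonneg_decomposition i alpha beta : nonneg alpha -> nonneg beta ->
  evec i = alpha + beta -> alpha = 0 \/ beta = 0.
Proof.
move=> a0 b0 e; have bE : beta = evec i - alpha by rewrite e addrC addKr.
case: (@nonneg_sub_evec1 alpha i) => // [|->|ea]; rewrite -?bE //.
  by left.
by right; rewrite bE ea subrr.
Qed.

Lemma evec_neg g p l : nonneg (g + evec p) -> g 0 l < 0 -> g 0 p = -1.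
Proof.
move=> gp gl; have := gp l; have := gp p; rewrite !mxE !eqxx /=.
by case: (l =P p) gl => [->|] /=; lia.
Qed.

(** With g = alpha + e_p, the condition on beta reads
    g <= e_i + e_q + e_p; at p this may be sharpened since g_p = 0, so that g
    is one of 0, e_i, e_q, e_i + e_q. A unit vector occurring in g is not e_p,
    which yields the distinctness conditions in the three types. *)
Lemma outer_decomposition i alpha beta p q :
    nonneg (alpha + evec p) -> nonneg (beta + evec q) ->
    alpha 0 p = -1 -> alpha <> - evec p -> evec i = alpha + beta ->
  [\/ typeA i alpha beta, typeB i alpha beta \/ typeB i beta alpha
    | typeC i alpha beta \/ typeC i beta alpha].
Proof.
move gE: (alpha + evec p) => g g0 bq ap1 anp eab.
have aE : alpha = g - evec p by rewrite -gE addrK.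
have bE : beta = evec i - g + evec p.
  by rewrite eab -gE opprD addrACA subrr add0r addrNK.
have gp : g 0 p = 0 by rewrite -gE mxE ap1 evecE eqxx.
have gNp j : (0 < g 0 j) -> j != p by apply: contraTneq => ->; rewrite gp.
have giq : nonneg (evec i + evec q - g).
  move=> h; have [->|nhp] := eqVneq h p.
    by rewrite !mxE gp !eqxx /=; case: eqP; case: eqP.
  by have := bq h; rewrite bE !mxE (negPf nhp) eqxx /=; lia.
case: (nonneg_sub_evec2 g0 giq) => {}gE.
- by case: anp; rewrite aE gE sub0r.
- have nip : i != p by rewrite gNp // gE evecE eqxx.
  constructor 1; exists p; split; rewrite 1?eq_sym //; first by rewrite aE gE.
  by rewrite bE gE subrr add0r.
- have nqp : q != p by rewrite gNp // gE evecE eqxx.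
  have [eqi|nqi] := eqVneq q i.
    constructor 1; exists p; split; first by rewrite eq_sym -eqi.
      by rewrite aE gE eqi.
    by rewrite bE gE eqi subrr add0r.
  have [epi|npi] := eqVneq p i.
    constructor 2; left; exists q; split=> //; first by rewrite aE gE epi.
    by rewrite bE gE epi addrAC mulr2n.
  constructor 3; left; exists q, p; split.
  - by rewrite /= !inE negb_or nqp nqi npi.
  - by rewrite aE gE.
  by rewrite bE gE.
have nip : i != p.
  by rewrite gNp // gE mxE !evecE eqxx; case: eqP.
have nqp : q != p.
  by rewrite gNp // gE mxE !evecE eqxx; case: eqP.
have bpq : beta = evec p - evec q by rewrite bE gE opprD addrA subrr add0r addrC.
have [eqi|nqi] := eqVneq q i.
  constructor 2; right; exists p; split; first by rewrite eq_sym.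
    by rewrite bpq eqi.
  by rewrite aE gE eqi mulr2n.
constructor 3; right; exists p, q; split=> //.
  by rewrite /= !inE negb_or ![p == _]eq_sym nqp nqi nip.
by rewrite aE gE addrAC.
Qed.

Lemma typeA_nonneg i alpha beta : typeA i alpha beta -> nonneg beta.
Proof. by case=> k [_ _ ->]; apply: nonneg_evec. Qed.

Lemma typeB_coord i alpha beta :
  typeB i alpha beta -> alpha 0 i = -1 /\ beta 0 i = 2.
Proof.
by case=> k [/negPf nki -> ->]; rewrite !mxE !eqxx /= eq_sym nki.
Qed.

Lemma typeB_neg i alpha beta :
  typeB i alpha beta -> ~ nonneg alpha /\ ~ nonneg beta.
Proof.
case=> k [nki -> ->].
split=> [/(_ i)|/(_ k)]; rewrite !mxE !eqxx /=.
  by rewrite eq_sym (negPf nki).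
by rewrite (negPf nki).
Qed.

Lemma typeC_coord i alpha beta :
  typeC i alpha beta -> alpha 0 i = 0 /\ beta 0 i = 1.
Proof.
case=> k [l [+ -> ->]]; rewrite /= !inE negb_or => /and3P[/andP[_ nki] nli _].
by rewrite !mxE !eqxx /= ![i == _]eq_sym (negPf nki) (negPf nli).
Qed.

Lemma typeC_neg i alpha beta :
  typeC i alpha beta -> ~ nonneg alpha /\ ~ nonneg beta.
Proof.
case=> k [l [+ -> ->]]; rewrite /= !inE negb_or => /and3P[/andP[nkl nki] nli _].
split=> [/(_ l)|/(_ k)]; rewrite !mxE !eqxx /=.
  by rewrite (eq_sym l) (negPf nkl).
by rewrite (negPf nkl) (negPf nki).
Qed.

End UnitVectors.

(** * Decompositions of a root into two roots *)

Lemma exactly_one_intro (P Q R : Prop) : [\/ P, Q | R] ->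
  ~ (P /\ Q) -> ~ (P /\ R) -> ~ (Q /\ R) -> exactly_one P Q R.
Proof.
by move=> PQR nPQ nPR nQR; case: PQR => H;
  [constructor 1|constructor 2|constructor 3]; split=> // H'; tauto.
Qed.

Theorem lemma4p7 (k : closedFieldType) (hk : [pchar k] =i pred0) (n : nat)
    (I : idealr {mpoly k[n]})
    (hmon : monomial_ideal I) (hcof : cofinite_support I)
    (hx : forall j : 'I_n, 'X_j \notin I)
    (i : 'I_n) (hi : is_root I (evec i))
    (alpha beta : 'rV[int]_n)
    (halpha : is_root I alpha) (hbeta : is_root I beta)
    (hsum : evec i = alpha + beta) :
  exactly_one (typeA i alpha beta \/ typeA i beta alpha)
              (typeB i alpha beta \/ typeB i beta alpha)
              (typeC i alpha beta \/ typeC i beta alpha).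
Proof.
apply: exactly_one_intro.
- have [p ap] := root_nonneg halpha; have [q bq] := root_nonneg hbeta.
  have [an|a0] := boolP [exists h, alpha 0 h < 0].
    have [h /(evec_neg ap) ap1] := existsP an.
    have := outer_decomposition ap bq ap1 (root_neq_oppevec hk hcof halpha) hsum.
    by case; [constructor 1; left|constructor 2|constructor 3].
  have [bn|b0] := boolP [exists h, beta 0 h < 0].
    have [h /(evec_neg bq) bq1] := existsP bn.
    rewrite addrC in hsum.
    have := outer_decomposition bq ap bq1 (root_neq_oppevec hk hcof hbeta) hsum.
    by case; [constructor 1; right|case; constructor 2; [right|left]
             |case; constructor 3; [right|left]].
  have inner (g : 'rV[int]_n) : ~~ [exists h, g 0 h < 0] -> nonneg g.
    by rewrite negb_exists => /forallP g0 h; have := g0 h; rewrite -leNgt.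
  by case: (nonneg_decomposition (inner _ a0) (inner _ b0) hsum) => e;
    [case: halpha|case: hbeta]; rewrite e eqxx.
- by case=> -[/typeA_nonneg ?|/typeA_nonneg ?] [/typeB_neg[]|/typeB_neg[]].
- by case=> -[/typeA_nonneg ?|/typeA_nonneg ?] [/typeC_neg[]|/typeC_neg[]].
by case=> -[/typeB_coord[a b]|/typeB_coord[a b]] [/typeC_coord[]|/typeC_coord[]];
  rewrite a b.
Qed.
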